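(* For any $\alpha>-1$, $\nu>0$ and $x>0$, $$\frac{L_{\nu+1}^{\alpha-1}(-x)}{L_{\nu}^{\alpha}(-x)}>\frac{\alpha+x-1+\sqrt{(\alpha+x+1)^2+4\nu x}}{2(\nu+1)} .$$
   Context: $L_\nu^\alpha$ denotes the Laguerre function $L_\nu^\alpha(x)=\dfrac{\Gamma(\nu+\alpha+1)}{\Gamma(\nu+1)\Gamma(\alpha+1)}\,{}_1F_1(-\nu;\alpha+1;x)$, which reduces to the generalized Laguerre polynomial when $\nu$ is a nonnegative integer. *)

(* Defs.v *)
From HB Require Import structures.
From mathcomp Require Import all_boot all_order all_algebra.
From mathcomp Require Import all_classical all_reals all_analysis.
Set Implicit Arguments. Unset Strict Implicit. Unset Printing Implicit Defensive.
Import Order.TTheory GRing.Theory Num.Theory.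
Import numFieldNormedType.Exports.
Local Open Scope classical_set_scope.
Local Open Scope ring_scope.

(* Euler's Gamma integral  Gamma s = int_0^oo t^(s-1) e^(-t) dt  (meaningful for s > 0). *)
Definition Gamma {R : realType} (s : R) : R :=
  Rintegral lebesgue_measure `]0%R, +oo[%classic (fun t : R => t `^ (s - 1) * expR (- t)).

(* Reciprocal Gamma 1/Gamma, extended to all reals via the functional equation:
   rGamma s = s (s+1) ... (s+N-1) / Gamma (s+N), with N = trunc(-s) + 1 so that s+N > 0.
   In particular rGamma vanishes at 0, -1, -2, ... *)
Definition rGamma {R : realType} (s : R) : R :=
  let N := (Num.truncn (- s)).+1 in
  (\prod_(k < N) (s + k%:R)) / Gamma (s + N%:R).

Definition poch {R : realType} (a : R) (k : nat) : R := \prod_(i < k) (a + i%:R).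

(* Laguerre function
   L_nu^alpha(x) = Gamma(nu+alpha+1)/(Gamma(nu+1) Gamma(alpha+1)) 1F1(-nu; alpha+1; x)
                 = Gamma(nu+alpha+1)/Gamma(nu+1) * sum_k (-nu)_k x^k / (k! Gamma(alpha+1+k)). *)
Definition Laguerre {R : realType} (nu alpha x : R) : R :=
  Gamma (nu + alpha + 1) / Gamma (nu + 1) *
  limn [series poch (- nu) k * x ^+ k / (k`!)%:R * rGamma (alpha + 1 + k%:R)]_k.

(* Main.v *)
Require Import Defs.
From HB Require Import structures.
From mathcomp Require Import all_boot all_order all_algebra.
From mathcomp Require Import all_classical all_reals all_analysis.
From mathcomp Require Import measurable_realfun ring lra.
Import Order.TTheory GRing.Theory Num.Theory.
Import numFieldNormedType.Exports.
Local Open Scope classical_set_scope.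
Local Open Scope ring_scope.

(** With b = alpha + 1, let M be the power series of L_nu^alpha(-x) stripped of
    its Gamma prefactor. It solves Kummer's equation
      x M'' + (b + x) M' = nu M,
    and comparing coefficients, the numerator L_(nu+1)^(alpha-1)(-x) is, up to
    its prefactor, (alpha + x) M + x M'. Writing q = M'/M, the claim becomes
      x q^2 + (b + x) q - nu > 0,
    whose left-hand side equals x (M'^2 - M M'') / M^2 by the equation: what has
    to be shown is that M is strictly log-concave on x > 0.

    Signs come from one principle: if x V' + beta V > 0 on x > 0 with beta > 0,
    then x^beta V increases from 0, so V > 0. It is applied to
      V = e^x M M'           (so M^2 increases and M does not vanish),
      V = e^x M'             (so M' > 0),
      V = e^x (M'^2 - M M'') (with beta = b + 1), where
        x V' + (b + 1) V = e^x (M'^2 + M M'). *)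

(** * The Gamma integral *)

Lemma is_derive_powR {R : realType} (s t : R) : 0 < t ->
  is_derive t (1 : R) (fun u : R => u `^ s) (s * t `^ (s - 1)).
Proof.
move=> t0; have ti : t \in `]0, +oo[ by rewrite in_itv/= andbT.
apply: DeriveDef; first exact: derivable_powR.
by rewrite -derive1E powR_derive1.
Qed.

Lemma is_derive_expRN {R : realType} (t : R) :
  is_derive t (1 : R) (fun u : R => expR (- u)) (- expR (- t)).
Proof.
apply: is_derive_eq; rewrite /GRing.scale/=.
ring.
Qed.

Lemma is_derive_powR_expRN {R : realType} (s t : R) : 0 < t ->
  is_derive t (1 : R) (fun u : R => u `^ s * expR (- u))
    (s * (t `^ (s - 1) * expR (- t)) - t `^ s * expR (- t)).
Proof.
move=> t0; have d1 := is_derive_powR s t t0; have d2 := is_derive_expRN t.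
apply: is_derive_eq; rewrite /GRing.scale/=; ring.
Qed.

(** For [x >= 1] the power is at most [x ^+ K] with an integer [K > s], while [expR x] is at least
    x^(K+1)/(K+1)!. Each term is thus at most (K+1)!/(n+2). *)
Lemma powR_expRN_cvg0 {R : realType} (s : R) : 0 < s ->
  (n.+2%:R : R) `^ s * expR (- n.+2%:R) @[n --> \oo] --> (0 : R).
Proof.
move=> s0; set K := (Num.truncn s).+1.
apply: (@squeeze_cvgr _ _ _ _ (fun=> 0) (fun n => K.+1`!%:R / n.+2%:R)).
- apply: nearW => n; apply/andP; split.
    by rewrite mulr_ge0// ?powR_ge0 ?expR_ge0.
  set x : R := n.+2%:R.
  have x1 : 1 <= x by rewrite ler1n.
  have x0 : 0 < x by lra.
  have h1 : x `^ s <= x ^+ K.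
    rewrite -powR_mulrn; last lra.
    apply: ler_powR => //; apply: ltW; exact: truncnS_gt.
  have h2 : x ^+ K.+1 / K.+1`!%:R <= expR x.
    have := expR_ge1Dxn K (ltW x0); lra.
  rewrite expRN ler_pdivrMr ?expR_gt0//.
  apply: (le_trans h1).
  have f0 : (0 : R) < K.+1`!%:R by rewrite ltr0n fact_gt0.
  move: h2; rewrite ler_pdivrMr// exprSr => h2.
  by rewrite mulrAC ler_pdivlMr// [K.+1`!%:R * _]mulrC.
- exact: cvg_cst.
- rewrite -(mulr0 (K.+1`!%:R : R)); apply: cvgM; first exact: cvg_cst.
  by have := @cvg_harmonic R; rewrite -cvg_shiftS.
Qed.

Section gamma_integral.
Context {R : realType}.
Implicit Types s t : R.
Local Notation mu := (@lebesgue_measure R).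

Definition gamma_density s t := t `^ (s - 1) * expR (- t).

(** Kept in the extended reals, so that limits of integrals can be taken before finiteness is
    known. *)
Definition gamma_integral s :=
  (\int[mu]_(t in `]0%R, +oo[) (gamma_density s t)%:E)%E.

Lemma GammaE s : Gamma s = fine (gamma_integral s).
Proof. by []. Qed.

Lemma gamma_density_ge0 s t : 0 <= gamma_density s t.
Proof. by rewrite mulr_ge0// ?powR_ge0 ?expR_ge0. Qed.

Lemma measurable_gamma_density s (D : set R) : measurable_fun D (gamma_density s).
Proof.
apply: (@measurable_funS _ _ _ _ setT) => //.
apply: measurable_funM; first exact: measurable_powR.
apply: (measurableT_comp (@measurable_expR R)); exact: measurable_funN.
Qed.

Lemma derivable_gamma_density s t : 0 < t -> derivable (gamma_density s) t 1.
Proof. by move=> t0; apply: ex_derive; exact: is_derive_powR_expRN. Qed.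

(** Compact intervals that exhaust the half-line and avoid 0, where the density may be singular. The
    shift by 2 keeps the lower endpoint strictly below the upper one. *)
Definition gamma_range (n : nat) : set R := `[n.+2%:R^-1, n.+2%:R]%classic.

Lemma gamma_range_subset m n : (m <= n)%N -> gamma_range m `<=` gamma_range n.
Proof.
move=> mn t; rewrite /gamma_range/= !in_itv/= => /andP[mt tm]; apply/andP; split.
  by apply: le_trans mt; rewrite lef_pV2 ?posrE// ler_nat ltnS.
by apply: le_trans tm _; rewrite ler_nat ltnS.
Qed.

Lemma bigcup_gamma_range : \bigcup_n gamma_range n = `]0%R, +oo[%classic.
Proof.
apply/seteqP; split => t.
  move=> [n _]; rewrite /gamma_range/= !in_itv/= andbT => /andP[+ _].
  by apply: lt_le_trans; rewrite invr_gt0.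
rewrite /= in_itv/= andbT => t0.
exists (maxn (Num.truncn t) (Num.truncn t^-1)) => //.
rewrite /gamma_range/= in_itv/=; apply/andP; split.
  rewrite -[leRHS]invrK lef_pV2 ?posrE ?invr_gt0//.
  apply/ltW/(lt_le_trans (truncnS_gt _)).
  by rewrite ler_nat ltnS leqW// leq_maxr.
apply/ltW/(lt_le_trans (truncnS_gt _)).
by rewrite ler_nat ltnS leqW// leq_maxl.
Qed.

Lemma gamma_range_cvg s :
  (\int[mu]_(t in gamma_range n) (gamma_density s t)%:E)%E @[n --> \oo]
  --> gamma_integral s.
Proof.
rewrite /gamma_integral -bigcup_gamma_range.
apply: ge0_nondecreasing_set_cvg_integral.
- by move=> m n mn; apply/subsetPset/gamma_range_subset.
- by move=> n; exact: measurable_itv.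
- by move=> n; apply/measurable_EFinP; exact: measurable_gamma_density.
- by move=> n t _; rewrite lee_fin gamma_density_ge0.
Qed.

Lemma within_continuous_gamma_density s n :
  {within gamma_range n, continuous (gamma_density s)}.
Proof.
apply: derivable_within_continuous => t; rewrite in_itv/= => /andP[nt _].
by apply: derivable_gamma_density; apply: lt_le_trans nt; rewrite invr_gt0.
Qed.

Lemma integrable_gamma_range s n :
  mu.-integrable (gamma_range n) (EFin \o gamma_density s).
Proof.
apply: continuous_compact_integrable; first exact: segment_compact.
exact: within_continuous_gamma_density.
Qed.

(** The fundamental theorem of calculus for t^s e^(-t), whose derivative is the difference of [s]
    times the density at [s] and the density at [s + 1]. Both integrals are finite on a compact
    interval, so the identity can be rearranged in the reals. *)
Lemma gamma_range_by_parts s n :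
  (\int[mu]_(t in gamma_range n) (gamma_density (s + 1) t)%:E =
   s%:E * \int[mu]_(t in gamma_range n) (gamma_density s t)%:E +
   (gamma_density (s + 1) n.+2%:R^-1 - gamma_density (s + 1) n.+2%:R)%:E)%E.
Proof.
have ab : (n.+2%:R^-1 : R) < n.+2%:R.
  apply: (@lt_trans _ _ 1); last by rewrite ltr1n.
  by rewrite invf_lt1 ?ltr0n// ltr1n.
have a0 : (0 : R) < n.+2%:R^-1 by rewrite invr_gt0.
have b0 : (0 : R) < n.+2%:R by [].
have dF t : 0 < t -> is_derive t (1 : R) (gamma_density (s + 1))
    (s * gamma_density s t - gamma_density (s + 1) t).
  by move=> /(is_derive_powR_expRN s); rewrite /gamma_density addrK.
have cF t : 0 < t -> {for t, continuous (gamma_density (s + 1))}.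
  move=> t0; apply/differentiable_continuous/derivable1_diffP.
  exact: derivable_gamma_density.
have := @continuous_FTC2 R
  (fun t => s * gamma_density s t - gamma_density (s + 1) t)
  (gamma_density (s + 1)) _ _ ab.
rewrite -/(gamma_range n) => FTC.
have {FTC} : (\int[mu]_(t in gamma_range n)
    (s * gamma_density s t - gamma_density (s + 1) t)%:E =
  (gamma_density (s + 1) n.+2%:R)%:E - (gamma_density (s + 1) n.+2%:R^-1)%:E)%E.
  apply: FTC.
  - apply: derivable_within_continuous => t; rewrite in_itv/= => /andP[nt _].
    have t0 : 0 < t by apply: lt_le_trans nt.
    apply: derivableB; last exact: derivable_gamma_density.
    apply: derivableM; first exact: derivable_cst.
    exact: derivable_gamma_density.
  - split.
    + move=> t; rewrite in_itv/= => /andP[nt _].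
      by apply: derivable_gamma_density; apply: lt_trans nt.
    + by apply/cvg_at_right_filter/cF.
    + by apply/cvg_at_left_filter/cF.
  - move=> t; rewrite in_itv/= => /andP[nt _].
    rewrite derive1E; apply: derive_val.
    by apply: dF; apply: lt_trans nt.
have mr : measurable (gamma_range n) by exact: measurable_itv.
under eq_integral do rewrite EFinB EFinM.
rewrite integralB//; last 2 first.
- apply: integrableZl => //; exact: integrable_gamma_range.
- exact: integrable_gamma_range.
rewrite integralZl//; last exact: integrable_gamma_range.
have /integrable_fin_num : mu.-integrable (gamma_range n) (EFin \o gamma_density s).
  exact: integrable_gamma_range.
have /integrable_fin_num : mu.-integrable (gamma_range n) (EFin \o gamma_density (s + 1)).
  exact: integrable_gamma_range.
move=> /(_ mr)/fineK <- /(_ mr)/fineK <-.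
rewrite -!EFinB -!EFinM -!EFinD => -[h]; congr (_%:E).
lra.
Qed.

(** Limit of the integration by parts over growing intervals. The boundary term at the lower end
    vanishes because [s > 0], the one at the upper end by exponential decay. *)
Lemma gamma_integralS s : 0 < s ->
  gamma_integral (s + 1) = (s%:E * gamma_integral s)%E.
Proof.
move=> s0.
have b0 : (gamma_density (s + 1) n.+2%:R^-1 - gamma_density (s + 1) n.+2%:R)%:E
    @[n --> \oo] --> (0%R)%:E.
  apply: cvg_EFin; first exact: nearW.
  rewrite -[X in _ --> X](subrr 0); apply: cvgB.
    rewrite /gamma_density addrK -(mul0r (expR (- 0) : R)); apply: cvgM.
      apply: ((cvg_at_rightP (fun t : R => t `^ s) 0 0).1 (powR_cvg0 s0)).
      split; first by move=> n; rewrite invr_gt0.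
      by have := @cvg_harmonic R; rewrite -cvg_shiftS.
    apply: (continuous_cvg _ (@continuous_expR R _)); apply: cvgN.
    by have := @cvg_harmonic R; rewrite -cvg_shiftS.
  by rewrite /gamma_density addrK; exact: powR_expRN_cvg0.
apply: (cvg_unique _ (gamma_range_cvg (s + 1))); first exact: ereal_hausdorff.
rewrite /=; under eq_cvg do rewrite gamma_range_by_parts.
rewrite -[(s%:E * gamma_integral s)%E]adde0.
apply: cvgeD => //.
  by rewrite fin_num_adde_defl.
apply: cvgeZl => //; exact: gamma_range_cvg.
Qed.

Lemma gamma_integral_ge0 s : (0 <= gamma_integral s)%E.
Proof. by apply: integral_ge0 => t _; rewrite lee_fin gamma_density_ge0. Qed.

Lemma gamma_integral1 : gamma_integral 1 = 1%E.
Proof.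
rewrite /gamma_integral.
rewrite integral_itv_obnd_cbnd; last first.
  by apply/measurable_EFinP; exact: measurable_gamma_density.
under eq_integral do rewrite /gamma_density subrr powRr0 mul1r.
rewrite (@ge0_continuous_FTC2y _ _ (fun t => - expR (- t)) 0 0).
- by rewrite oppr0 expR0 EFinN oppeK add0e.
- by move=> t _; exact: expR_ge0.
- apply: derivable_within_continuous => t _; apply: ex_derive.
- rewrite -[X in _ --> X]oppr0; apply: cvgN; exact: cvgr_expR.
- by move=> t _; apply: ex_derive.
- apply: cvg_at_right_filter.
  suff : {for 0, continuous (fun t : R => - expR (- t))} by [].
  by apply/differentiable_continuous/derivable1_diffP; exact: ex_derive.
- move=> t _; rewrite derive1E; apply: derive_val.
  apply: is_derive_eq; rewrite /GRing.scale/=; ring.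
Qed.

(** Pointwise, t^(s-1) is at most t^(s2-1) when [t >= 1] and at most t^(s1-1) when [t <= 1]. *)
Lemma gamma_integral_le_add s1 s s2 : s1 <= s <= s2 ->
  (gamma_integral s <= gamma_integral s1 + gamma_integral s2)%E.
Proof.
move=> /andP[s1s ss2].
rewrite /gamma_integral -ge0_integralD//=; last 4 first.
- by move=> t _; rewrite lee_fin gamma_density_ge0.
- by apply/measurable_EFinP; exact: measurable_gamma_density.
- by move=> t _; rewrite lee_fin gamma_density_ge0.
- by apply/measurable_EFinP; exact: measurable_gamma_density.
apply: ge0_le_integral => //=.
- by move=> t _; rewrite lee_fin gamma_density_ge0.
- by apply/measurable_EFinP; exact: measurable_gamma_density.
- apply/measurable_EFinP; apply: measurable_funD; exact: measurable_gamma_density.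
move=> t; rewrite in_itv/= andbT => t0.
rewrite -EFinD lee_fin /gamma_density -mulrDl ler_wpM2r ?expR_ge0//.
have [t1|/ltW t1] := leP 1 t.
  by rewrite ler_wpDl ?powR_ge0// ler_powR// lerD2r.
by rewrite ler_wpDr ?powR_ge0// ger_powR ?t0// lerD2r.
Qed.

Lemma gamma_integral_nat n : (gamma_integral n.+1%:R < +oo)%E.
Proof.
elim: n => [|n IH]; first by rewrite gamma_integral1 ltry.
by rewrite -natr1 gamma_integralS// lte_mul_pinfty.
Qed.

(** An exponent at least 1 lies between 1 and some integer, where the functional equation gives
    finiteness. For [s > 0] finiteness at [s + 1] carries back to [s], since an infinite value would
    stay infinite after multiplication by [s]. *)
Lemma gamma_integral_lty s : 0 < s -> (gamma_integral s < +oo)%E.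
Proof.
have ge1 r : 1 <= r -> (gamma_integral r < +oo)%E.
  move=> r1; apply: (le_lt_trans (@gamma_integral_le_add 1 r (Num.truncn r).+1%:R _)).
    by rewrite r1 ltW// truncnS_gt.
  by apply: lte_add_pinfty; [rewrite gamma_integral1 ltry|exact: gamma_integral_nat].
move=> s0; have : (gamma_integral (s + 1) < +oo)%E by apply: ge1; lra.
rewrite gamma_integralS//; apply: contraTT; rewrite -!leNgt leye_eq => /eqP ->.
by rewrite gt0_muley ?lte_fin.
Qed.

Lemma gamma_integral_fin_num s : 0 < s -> gamma_integral s \is a fin_num.
Proof.
by move=> s0; rewrite ge0_fin_numE ?gamma_integral_lty// gamma_integral_ge0.
Qed.

(** On [1, 2] the density is at least e^(-2)/2, because t^(s-1) >= 1/t >= 1/2 there. *)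
Lemma gamma_integral_gt0 s : 0 < s -> (0 < gamma_integral s)%E.
Proof.
move=> s0; have c0 : 0 < 2^-1 * expR (- 2) :> R by rewrite mulr_gt0 ?expR_gt0.
apply: (@lt_le_trans _ _ (\int[mu]_(t in `[1%R, 2%R]) (2^-1 * expR (- 2))%:E)%E).
  rewrite integral_cst//= lebesgue_measure_itv/= lte_fin ltr1n/=.
  by rewrite -EFinB -EFinM lte_fin mulr_gt0//; lra.
apply: (@le_trans _ _ (\int[mu]_(t in `[1%R, 2%R]) (gamma_density s t)%:E)%E).
  apply: ge0_le_integral => //=.
  - by apply/measurable_EFinP; exact: measurable_gamma_density.
  move=> t; rewrite in_itv/= => /andP[t1 t2].
  rewrite lee_fin ler_pM ?expR_ge0 ?invr_ge0//; last by rewrite ler_expR lerN2.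
  apply: (@le_trans _ _ (t `^ (-1))); last by rewrite ler_powR//; lra.
  by rewrite powR_inv1 ?lef_pV2 ?posrE//; lra.
apply: ge0_subset_integral => //=.
- by apply/measurable_EFinP; exact: measurable_gamma_density.
- by move=> t _; rewrite lee_fin gamma_density_ge0.
- by move=> t; rewrite /= !in_itv/= => /andP[t1 _]; rewrite andbT; lra.
Qed.

End gamma_integral.

(** * Functional equations of Gamma and its reciprocal *)

Lemma Gamma_gt0 {R : realType} (s : R) : 0 < s -> 0 < Gamma s.
Proof.
move=> s0; rewrite GammaE fine_gt0// gamma_integral_gt0//=.
exact: gamma_integral_lty.
Qed.

Lemma GammaS {R : realType} (s : R) : 0 < s -> Gamma (s + 1) = s * Gamma s.
Proof.
move=> s0; rewrite !GammaE gamma_integralS// fineM//.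
exact: gamma_integral_fin_num.
Qed.

(** [Num.truncn] is 0 on every real below 1, negative ones included, so N = 1 in the definition. The
    range [-1 < s] matters because [s = alpha], possibly nonpositive, occurs in the constant
    coefficient of the numerator. *)
Lemma rGammaE {R : realType} (s : R) : -1 < s -> rGamma s = s / Gamma (s + 1).
Proof.
move=> s1; rewrite /rGamma (_ : Num.truncn (- s) = 0%N).
  by rewrite big_ord1 addr0.
by apply/truncn0Pn; rewrite -ltNge; lra.
Qed.

Lemma rGamma_gt0 {R : realType} (s : R) : 0 < s -> 0 < rGamma s.
Proof.
move=> s0; rewrite rGammaE; last lra.
by rewrite divr_gt0// Gamma_gt0//; lra.
Qed.

Lemma rGamma_mulS {R : realType} (s : R) : -1 < s ->
  rGamma s = s * rGamma (s + 1).
Proof.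
move=> s1; rewrite !rGammaE//; last lra.
rewrite (GammaS (s + 1)); last lra.
have g0 : Gamma (s + 1) != 0 by rewrite gt_eqF// Gamma_gt0//; lra.
have s10 : s + 1 != 0 by rewrite gt_eqF//; lra.
by field; rewrite g0 s10.
Qed.

(** * Power series with factorially small coefficients *)

Section exponential_bound.
Context {R : realType}.
Implicit Types (c : R^nat) (x : R).

(** Majorization by the coefficients of C e^(Kx). It gives convergence everywhere and is stable
    under formal differentiation with the same [K]. *)
Definition exponentially_bounded c :=
  exists C K : R, 0 <= K /\ forall k, `|c k| <= C * K ^+ k / k`!%:R.

Definition psum c x : R := limn (pseries c x).

Lemma exponentially_bounded_diffs c :
  exponentially_bounded c -> exponentially_bounded (pseries_diffs c).
Proof.
move=> [C [K [K0 cK]]]; exists (C * K), K; split => // k.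
rewrite /pseries_diffs normrM normr_nat.
have h : k.+1%:R != 0 :> R by rewrite pnatr_eq0.
have f0 : k`!%:R != 0 :> R by rewrite pnatr_eq0 -lt0n fact_gt0.
apply: (le_trans (ler_wpM2l (ler0n _ _) (cK k.+1))).
rewrite factS natrM exprS le_eqVlt; apply/orP; left; apply/eqP.
by field; rewrite f0 nat1r h.
Qed.

Lemma is_cvg_pseries_exponentially_bounded c x :
  exponentially_bounded c -> cvgn (pseries c x).
Proof.
move=> [C [K [K0 cK]]]; apply: normed_cvg.
apply: (@series_le_cvg _ _ (fun k => C * exp_coeff (K * `|x|) k)).
- by move=> k; exact: normr_ge0.
- move=> k; rewrite (le_trans (normr_ge0 (c k * x ^+ k)))// normrM normrX.
  rewrite /exp_coeff/= exprMn.
  have := ler_wpM2r (exprn_ge0 k (normr_ge0 x)) (cK k).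
  by rewrite !mulrA [X in _ <= X -> _]mulrAC.
- move=> k; rewrite /= normrM normrX /exp_coeff/= exprMn.
  have := ler_wpM2r (exprn_ge0 k (normr_ge0 x)) (cK k).
  by rewrite !mulrA [X in _ <= X -> _]mulrAC.
- by apply: is_cvg_seriesZ; exact: is_cvg_series_exp_coeff.
Qed.

Lemma cvg_psum c x : exponentially_bounded c -> pseries c x @ \oo --> psum c x.
Proof. exact: is_cvg_pseries_exponentially_bounded. Qed.

Lemma psum0 c : psum c 0 = c 0%N.
Proof.
apply/cvg_lim => //; rewrite -cvg_shiftS.
apply: (@cvg_trans _ ((fun=> c 0%N) @ \oo)); last exact: cvg_cst.
apply: near_eq_cvg; apply: nearW => n /=.
rewrite /pseries/series/= big_nat_recl//= expr0 mulr1 big1 ?addr0// => i _.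
by rewrite expr0n mulr0.
Qed.

Lemma is_derive_psum c x : exponentially_bounded c ->
  is_derive x (1 : R) (psum c) (psum (pseries_diffs c) x).
Proof.
(* Termwise differentiation asks for convergence of the series and of its first two formal
   derivatives at a point of modulus above [|x|]. *)
move=> cb; apply: (@pseries_snd_diffs _ _ (`|x| + 1)).
- exact: is_cvg_pseries_exponentially_bounded.
- by apply: is_cvg_pseries_exponentially_bounded; exact: exponentially_bounded_diffs.
- apply: is_cvg_pseries_exponentially_bounded.
  by do 2 apply: exponentially_bounded_diffs.
- by rewrite [ltRHS]ger0_norm ?addr_ge0// ltrDl.
Qed.

End exponential_bound.

(** * Sign of a function from a weighted derivative *)

Section weighted_sign.
Context {R : realType}.
Implicit Types (V dV : R -> R) (beta x : R).

(** The mean value theorem on [0, x] for u^beta V(u), which is 0 at the origin since [beta > 0].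
    Continuity at 0 is checked apart, as u^beta need not be differentiable there. *)
Lemma powR_mean_value V dV beta x : 0 < beta -> 0 < x ->
  (forall t : R, is_derive t (1 : R) V (dV t)) ->
  exists2 t, 0 < t < x &
    x `^ beta * V x = t `^ (beta - 1) * (t * dV t + beta * V t) * x.
Proof.
move=> b0 x0 dV_.
have cV (t : R) : {for t, continuous V}.
  by apply/differentiable_continuous/derivable1_diffP; apply: ex_derive.
have dG (t : R) : 0 < t -> is_derive t (1 : R) (fun u => u `^ beta * V u)
    (t `^ (beta - 1) * (t * dV t + beta * V t)).
  move=> t0; have d1 := is_derive_powR beta t t0.
  apply: is_derive_eq; rewrite /GRing.scale/=.
  rewrite -(mulr_powRB1 (ltW t0) b0); ring.
have dG' (t : R) : t \in `]0, x[ -> is_derive t (1 : R)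
    (fun u => u `^ beta * V u) (t `^ (beta - 1) * (t * dV t + beta * V t)).
  by rewrite in_itv/= => /andP[t0 _]; exact: dG.
have cG : {within `[0, x], continuous (fun u => u `^ beta * V u)}.
  have cG (t : R) : 0 < t -> {for t, continuous (fun u => u `^ beta * V u)}.
    move=> t0; apply/differentiable_continuous/derivable1_diffP.
    by have h := dG _ t0; apply: ex_derive.
  apply/continuous_within_itvP => //; split.
  - by move=> t; rewrite in_itv/= => /andP[t0 _]; exact: cG.
  - rewrite powR0 ?gt_eqF//; apply: cvgM; first exact: powR_cvg0.
    by apply/cvg_at_right_filter/cV.
  - by apply/cvg_at_left_filter/cG.
have [t] := MVT x0 dG' cG.
rewrite in_itv/= => tx; rewrite powR0 ?gt_eqF// mul0r !subr0 => ->.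
by exists t.
Qed.

Lemma gt0_of_weighted_derive V dV beta x : 0 < beta -> 0 < x ->
  (forall t : R, is_derive t (1 : R) V (dV t)) ->
  (forall t : R, 0 < t -> 0 < t * dV t + beta * V t) -> 0 < V x.
Proof.
move=> b0 x0 dV_ pos; have [t /andP[t0 _] eq] := powR_mean_value _ _ _ _ b0 x0 dV_.
rewrite -(pmulr_rgt0 _ (powR_gt0 beta x0)) eq.
by rewrite !mulr_gt0// ?powR_gt0// pos.
Qed.

(** The weak form serves as long as M is not yet known to be nonzero. *)
Lemma ge0_of_weighted_derive V dV beta x : 0 < beta -> 0 < x ->
  (forall t : R, is_derive t (1 : R) V (dV t)) ->
  (forall t : R, 0 < t -> 0 <= t * dV t + beta * V t) -> 0 <= V x.
Proof.
move=> b0 x0 dV_ pos; have [t /andP[t0 _] eq] := powR_mean_value _ _ _ _ b0 x0 dV_.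
rewrite -(pmulr_rge0 _ (powR_gt0 beta x0)) eq.
by rewrite !mulr_ge0// ?powR_ge0 ?pos ?ltW.
Qed.

End weighted_sign.

(** * Kummer's equation *)

Section kummer.
Context {R : realType}.
Implicit Types (c : R^nat) (b nu x : R).

(** The coefficient of x^k in x M'' + (b + x) M' = nu M. *)
Definition kummer_coef b nu c :=
  forall k, k.+1%:R * (b + k%:R) * c k.+1 = (nu - k%:R) * c k.

(** Differentiating Kummer's equation gives x M''' + (b + 1 + x) M'' = (nu - 1) M'. *)
Lemma kummer_coef_diffs b nu c :
  kummer_coef b nu c -> kummer_coef (b + 1) (nu - 1) (pseries_diffs c).
Proof.
move=> rec k; have := rec k.+1; rewrite /pseries_diffs -!natr1 => eq.
transitivity ((k%:R + 1) * ((k%:R + 1 + 1) * (b + (k%:R + 1)) * c k.+2)).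
  by ring.
by rewrite eq; ring.
Qed.

(** With K = 1 + |nu|/b one has |nu - k| <= |nu| + k <= K (b + k), so the recurrence multiplies the
    modulus by at most K/(k + 1) at each index. *)
Lemma kummer_coef_bounded b nu c : 0 < b ->
  kummer_coef b nu c -> exponentially_bounded c.
Proof.
move=> b0 rec; have K0 : 0 <= 1 + `|nu| / b.
  by rewrite addr_ge0// divr_ge0// ltW.
exists `|c 0%N|, (1 + `|nu| / b); split => //; elim => [|k IH].
  by rewrite expr0 fact0 mulr1 divr1.
have bk : 0 < b + k%:R by rewrite ltr_wpDr.
have h : `|nu - k%:R| <= (1 + `|nu| / b) * (b + k%:R).
  apply: (le_trans (ler_normB _ _)); rewrite normr_nat.
  have -> : (1 + `|nu| / b) * (b + k%:R) = `|nu| + k%:R + (b + `|nu| / b * k%:R).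
    by field; rewrite gt_eqF.
  by rewrite lerDl addr_ge0 ?(ltW b0)// mulr_ge0// divr_ge0// ltW.
have -> : c k.+1 = (nu - k%:R) * c k / (k.+1%:R * (b + k%:R)).
  rewrite -rec mulrC mulrA mulVf ?mul1r// mulf_neq0 ?pnatr_eq0//.
  by rewrite gt_eqF.
rewrite normrM normfV normrM [`|_ * (b + _)|]ger0_norm; last by rewrite mulr_ge0// ltW.
rewrite ler_pdivrMr; last by rewrite mulr_gt0.
apply: (le_trans (ler_pM (normr_ge0 _) (normr_ge0 _) h IH)).
rewrite factS natrM exprS le_eqVlt; apply/orP; left; apply/eqP.
have f0 : k`!%:R != 0 :> R by rewrite pnatr_eq0 -lt0n fact_gt0.
have h1 : k.+1%:R != 0 :> R by rewrite pnatr_eq0.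
by field; rewrite f0 nat1r h1 gt_eqF.
Qed.

(* The partial sums of the two sides differ by terms of convergent series, which
   tend to 0. *)
Lemma psum_kummer_ode b nu c x : exponentially_bounded c -> kummer_coef b nu c ->
  x * psum (pseries_diffs (pseries_diffs c)) x +
  (b + x) * psum (pseries_diffs c) x = nu * psum c x.
Proof.
move=> cb rec.
have cb1 := exponentially_bounded_diffs _ cb.
have cb2 := exponentially_bounded_diffs _ cb1.
apply/eqP; rewrite -subr_eq0; apply/eqP.
apply: (cvg_unique _ (_ : (fun n => x * pseries (pseries_diffs (pseries_diffs c)) x n.+1 +
  (b + x) * pseries (pseries_diffs c) x n.+1 - nu * pseries c x n.+1) @ \oo --> _)).
- exact: norm_hausdorff.
- rewrite /=; apply: cvgB; last first.
    by apply: cvgM; [exact: cvg_cst|rewrite cvg_shiftS; exact: cvg_psum].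
  apply: cvgD; apply: cvgM; (try exact: cvg_cst);
    by rewrite cvg_shiftS; exact: cvg_psum.
- rewrite /=.
  have E n : x * pseries (pseries_diffs (pseries_diffs c)) x n.+1 +
      (b + x) * pseries (pseries_diffs c) x n.+1 - nu * pseries c x n.+1 =
      x * (pseries_diffs (pseries_diffs c) n * x ^+ n) +
      x * (pseries_diffs c n * x ^+ n).
    elim: n => [|n IH].
      rewrite /pseries/series/= !big_nat1 /pseries_diffs !expr0 !mulr1.
      have := rec 0%N; rewrite addr0 subr0 mul1r => <-; ring.
    have S d : pseries d x n.+2 = pseries d x n.+1 + d n.+1 * x ^+ n.+1.
      by rewrite /pseries/series/= big_nat_recr.
    rewrite !S.
    transitivity ((x * pseries (pseries_diffs (pseries_diffs c)) x n.+1 +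
      (b + x) * pseries (pseries_diffs c) x n.+1 - nu * pseries c x n.+1) +
      (x * pseries_diffs (pseries_diffs c) n.+1 + (b + x) * pseries_diffs c n.+1
        - nu * c n.+1) * x ^+ n.+1); first by ring.
    rewrite IH /pseries_diffs !exprS.
    have eq : nu * c n.+1 = n.+2%:R * (b + n.+1%:R) * c n.+2 + n.+1%:R * c n.+1.
      by rewrite (rec n.+1); ring.
    by rewrite eq -!natr1; ring.
  have Z : x * (pseries_diffs (pseries_diffs c) n * x ^+ n) +
      x * (pseries_diffs c n * x ^+ n) @[n --> \oo] --> x * 0 + x * 0.
    apply: cvgD; apply: cvgM; (try exact: cvg_cst); apply: cvg_series_cvg_0;
      exact: is_cvg_pseries_exponentially_bounded.
  rewrite mulr0 addr0 in Z.
  by under eq_cvg do rewrite E.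
Qed.

(** The coefficients may change sign once [k > nu], so positivity of M cannot be read off termwise.
    Instead M^2 is nondecreasing, because M M' >= 0. *)
Lemma psum_kummer_sq_ge b nu c x : 0 < b -> 0 < nu -> 0 < x ->
  kummer_coef b nu c -> c 0%N ^+ 2 <= psum c x ^+ 2.
Proof.
move=> b0 nu0 x0 rec; have cb := kummer_coef_bounded _ _ _ b0 rec.
have cb1 := exponentially_bounded_diffs _ cb.
have dM (t : R) := is_derive_psum c t cb.
have dM1 (t : R) := is_derive_psum _ t cb1.
have ge0 (t : R) : 0 < t -> 0 <= psum c t * psum (pseries_diffs c) t.
  move=> t0; rewrite -(pmulr_rge0 _ (expR_gt0 t)).
  pose V (t : R) := expR t * (psum c t * psum (pseries_diffs c) t).
  apply: (@ge0_of_weighted_derive _ V (fun t => V t + expR t *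
    (psum (pseries_diffs c) t ^+ 2 + psum c t * psum (pseries_diffs (pseries_diffs c)) t))
    b) => //.
    by move=> u; apply: is_derive_eq; rewrite /V /GRing.scale/=; ring.
  move=> u u0; have ode := psum_kummer_ode b nu c u cb rec.
  (* The left side is e^u (u M'^2 + M (u M'' + (b + u) M')), and the equation turns the inner
     bracket into nu M. *)
  rewrite (_ : _ + _ = expR u * (nu * psum c u ^+ 2 + u * psum (pseries_diffs c) u ^+ 2)).
    rewrite mulr_ge0 ?expR_ge0// addr_ge0//;
      by apply: mulr_ge0; [exact: ltW|exact: sqr_ge0].
  by rewrite expr2 [nu * _]mulrA -ode /V; ring.
have dS (t : R) : t \in `]0, x[ -> is_derive t (1 : R) (fun t => psum c t ^+ 2)
    (2 * (psum c t * psum (pseries_diffs c) t)).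
  by move=> _; apply: is_derive_eq; rewrite /GRing.scale/=; ring.
have [|t + eq] := MVT x0 dS _.
  by apply: derivable_within_continuous => t _; apply: ex_derive.
rewrite in_itv/= => /andP[t0 _].
by rewrite psum0 in eq; rewrite -subr_ge0 eq subr0 mulr_ge0 ?(ltW x0)// mulr_ge0 ?ge0.
Qed.

(** M starts at [c 0 > 0]. If it were nonpositive at [x], it would vanish at some point of [0, x],
    against M^2 >= c_0^2. *)
Lemma psum_kummer_gt0 b nu c x : 0 < b -> 0 < nu -> 0 < x ->
  kummer_coef b nu c -> 0 < c 0%N -> 0 < psum c x.
Proof.
move=> b0 nu0 x0 rec c0; rewrite ltNge; apply/negP => Mx.
have cb := kummer_coef_bounded _ _ _ b0 rec.
have dM (t : R) := is_derive_psum c t cb.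
have [||t] := @IVT _ (psum c) 0 x 0 (ltW x0).
- by apply: derivable_within_continuous => t _; apply: ex_derive.
- by rewrite psum0 ge_min Mx orbT le_max ltW.
rewrite in_itv/= => /andP[]; rewrite le_eqVlt => /orP[/eqP<- _|t0 _ Mt].
  by rewrite psum0 => h; rewrite h ltxx in c0.
have := psum_kummer_sq_ge _ _ _ _ b0 nu0 t0 rec.
by rewrite Mt expr0n/= leNgt exprn_gt0.
Qed.

Lemma psum_kummer_derive_gt0 b nu c x : 0 < b -> 0 < nu -> 0 < x ->
  kummer_coef b nu c -> 0 < c 0%N -> 0 < psum (pseries_diffs c) x.
Proof.
move=> b0 nu0 x0 rec c0; have cb := kummer_coef_bounded _ _ _ b0 rec.
have cb1 := exponentially_bounded_diffs _ cb.
have dM1 (t : R) := is_derive_psum _ t cb1.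
rewrite -(pmulr_rgt0 _ (expR_gt0 x)).
pose V (t : R) := expR t * psum (pseries_diffs c) t.
apply: (@gt0_of_weighted_derive _ V (fun t => V t + expR t *
  psum (pseries_diffs (pseries_diffs c)) t) b) => //.
  by move=> u; apply: is_derive_eq; rewrite /V /GRing.scale/=; ring.
move=> u u0; have ode := psum_kummer_ode b nu c u cb rec.
rewrite (_ : _ + _ = expR u * (nu * psum c u)).
  by rewrite !mulr_gt0 ?expR_gt0// (psum_kummer_gt0 b nu).
by rewrite -ode /V; ring.
Qed.

Lemma psum_kummer_log_concave b nu c x : 0 < b -> 0 < nu -> 0 < x ->
  kummer_coef b nu c -> 0 < c 0%N ->
  psum c x * psum (pseries_diffs (pseries_diffs c)) x < psum (pseries_diffs c) x ^+ 2.
Proof.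
move=> b0 nu0 x0 rec c0; have cb := kummer_coef_bounded _ _ _ b0 rec.
have cb1 := exponentially_bounded_diffs _ cb.
have cb2 := exponentially_bounded_diffs _ cb1.
have dM (t : R) := is_derive_psum _ t cb.
have dM1 (t : R) := is_derive_psum _ t cb1.
have dM2 (t : R) := is_derive_psum _ t cb2.
rewrite -subr_gt0 -(pmulr_rgt0 _ (expR_gt0 x)).
set c1 := pseries_diffs c in cb1 cb2 dM dM1 dM2 *.
set c2 := pseries_diffs c1 in cb2 dM1 dM2 *.
set c3 := pseries_diffs c2 in dM2 *.
pose V (t : R) := expR t * (psum c1 t ^+ 2 - psum c t * psum c2 t).
apply: (@gt0_of_weighted_derive _ V (fun t => V t + expR t *
  (psum c1 t * psum c2 t - psum c t * psum c3 t)) (b + 1)) => //; first by lra.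
  by move=> u; apply: is_derive_eq; rewrite /V /GRing.scale/=; ring.
move=> u u0; have ode := psum_kummer_ode b nu c u cb rec.
have ode1 := psum_kummer_ode _ _ _ u cb1 (kummer_coef_diffs _ _ _ rec).
have M0 : 0 < psum c u by exact: (psum_kummer_gt0 b nu).
have M1 : 0 < psum c1 u by exact: (psum_kummer_derive_gt0 b nu).
rewrite (_ : _ + _ = expR u * (psum c1 u ^+ 2 + psum c u * psum c1 u)).
  by rewrite mulr_gt0 ?expR_gt0// addr_gt0 ?mulr_gt0 ?exprn_gt0.
rewrite -/c1 -/c2 -/c3 in ode ode1.
(* M' times Kummer's equation minus M times the differentiated one, plus M'^2. The right-hand sides
   nu M M' and (nu - 1) M M' differ by M M'. *)
transitivity (expR u * (psum c1 u * (u * psum c2 u + (b + u) * psum c1 u)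
  - psum c u * (u * psum c3 u + (b + 1 + u) * psum c2 u) + psum c1 u ^+ 2)).
  by rewrite /V; ring.
by rewrite ode ode1; ring.
Qed.

End kummer.

(** * Laguerre functions *)

Section contiguous.
Context {R : realType}.

(** The coefficient of x^(k+1) in (a + x) M + x M' is a c_(k+1) + c_k + (k + 1) c_(k+1). *)
Lemma psum_contiguous (a x : R) (c f : R^nat) : exponentially_bounded c ->
  f 0%N = a * c 0%N ->
  (forall k, f k.+1 = (a + 1 + k%:R) * c k.+1 + c k) ->
  psum f x = (a + x) * psum c x + x * psum (pseries_diffs c) x.
Proof.
move=> cb f0 fS; have cb1 := exponentially_bounded_diffs _ cb.
have S0 d : pseries d x 0 = 0 by rewrite /pseries/series/= big_geq.
have S d k : pseries d x k.+1 = pseries d x k + d k * x ^+ k.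
  by rewrite /pseries/series/= big_nat_recr.
(* Stopping the series multiplied by [x] one index earlier makes the identity exact, with no
   remainder. *)
have E n : pseries f x n.+1 =
    a * pseries c x n.+1 + x * pseries c x n + x * pseries (pseries_diffs c) x n.
  elim: n => [|n IH].
    by rewrite (S f) (S c 0%N) !S0 f0 expr0; ring.
  rewrite (S f) IH (S c n.+1) (S c n) (S (pseries_diffs c) n) fS.
  by rewrite /pseries_diffs exprS -natr1; ring.
have L : a * pseries c x n.+1 + x * pseries c x n + x * pseries (pseries_diffs c) x n
    @[n --> \oo] --> a * psum c x + x * psum c x + x * psum (pseries_diffs c) x.
  apply: cvgD; [apply: cvgD|]; apply: cvgM; (try exact: cvg_cst).
  - by rewrite cvg_shiftS; exact: cvg_psum.
  - exact: cvg_psum.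
  - exact: cvg_psum.
rewrite [(a + x) * _]mulrDl; apply/cvg_lim => //.
rewrite -cvg_shiftS; apply: cvg_trans L; apply: near_eq_cvg.
by apply: nearW => n; exact/esym/E.
Qed.

End contiguous.

Section laguerre.
Context {R : realType}.
Implicit Types (alpha nu x : R).

(** The sign absorbs the argument -x: (-1)^k (-nu)_k = nu (nu - 1) ... (nu - k + 1). *)
Definition laguerre_coef nu alpha (k : nat) : R :=
  (-1) ^+ k * poch (- nu) k / k`!%:R * rGamma (alpha + 1 + k%:R).

Lemma LaguerreN nu alpha x : Laguerre nu alpha (- x) =
  Gamma (nu + alpha + 1) / Gamma (nu + 1) * psum (laguerre_coef nu alpha) x.
Proof.
rewrite /Laguerre /psum /pseries; congr (_ * _).
suff -> : [sequence poch (- nu) k * (- x) ^+ k / k`!%:R * rGamma (alpha + 1 + k%:R)]_k =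
  [sequence laguerre_coef nu alpha k * x ^+ k]_k by [].
apply/funext => k /=; rewrite /laguerre_coef -[- x]mulN1r exprMn; ring.
Qed.

Lemma poch_recr (a : R) k : poch a k.+1 = poch a k * (a + k%:R).
Proof. by rewrite /poch big_ord_recr. Qed.

Lemma poch_recl (a : R) k : poch a k.+1 = a * poch (a + 1) k.
Proof.
rewrite /poch big_ord_recl/= addr0; congr (_ * _); apply: eq_bigr => i _.
by rewrite /bump/= natrD addrA.
Qed.

Lemma laguerre_coef0 nu alpha : laguerre_coef nu alpha 0 = rGamma (alpha + 1).
Proof.
by rewrite /laguerre_coef expr0 /poch big_ord0 fact0 divr1 !mul1r addr0.
Qed.

Lemma laguerre_coef_kummer nu alpha : -1 < alpha ->
  kummer_coef (alpha + 1) nu (laguerre_coef nu alpha).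
Proof.
move=> a1 k; have k0 : (0 : R) <= k%:R by [].
have h1 : k.+1%:R != 0 :> R by rewrite pnatr_eq0.
have f0 : k`!%:R != 0 :> R by rewrite pnatr_eq0 -lt0n fact_gt0.
rewrite /laguerre_coef poch_recr factS natrM exprS.
rewrite (rGamma_mulS (alpha + 1 + k%:R)); last by lra.
rewrite (_ : alpha + 1 + k.+1%:R = alpha + 1 + k%:R + 1); last by rewrite -natr1 addrA.
by field; rewrite f0 nat1r h1.
Qed.

Lemma laguerre_coef_contiguous0 nu alpha : -1 < alpha ->
  laguerre_coef (nu + 1) (alpha - 1) 0 = alpha * laguerre_coef nu alpha 0.
Proof.
move=> a1; rewrite 2!laguerre_coef0 (_ : alpha - 1 + 1 = alpha); last exact: subrK.
exact: rGamma_mulS.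
Qed.

(** Once the common factors are removed this is nu + 1 = (nu - k) + (k + 1), by (-nu-1)_(k+1) =
    (-nu-1) (-nu)_k and the functional equation of [rGamma]. *)
Lemma laguerre_coef_contiguous nu alpha k : -1 < alpha ->
  laguerre_coef (nu + 1) (alpha - 1) k.+1 =
  (alpha + 1 + k%:R) * laguerre_coef nu alpha k.+1 + laguerre_coef nu alpha k.
Proof.
move=> a1; have k0 : (0 : R) <= k%:R by [].
have h1 : k.+1%:R != 0 :> R by rewrite pnatr_eq0.
have f0 : k`!%:R != 0 :> R by rewrite pnatr_eq0 -lt0n fact_gt0.
rewrite /laguerre_coef poch_recl poch_recr factS natrM exprS.
rewrite (_ : - (nu + 1) + 1 = - nu); last by ring.
rewrite (_ : alpha - 1 + 1 + k.+1%:R = alpha + 1 + k%:R); last by rewrite -natr1; ring.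
rewrite (_ : alpha + 1 + k.+1%:R = alpha + 1 + k%:R + 1); last by rewrite -natr1 addrA.
rewrite (rGamma_mulS (alpha + 1 + k%:R)); last by lra.
by field; rewrite f0 nat1r h1.
Qed.

Lemma psum_laguerre_contiguous nu alpha x : -1 < alpha ->
  psum (laguerre_coef (nu + 1) (alpha - 1)) x =
  (alpha + x) * psum (laguerre_coef nu alpha) x +
  x * psum (pseries_diffs (laguerre_coef nu alpha)) x.
Proof.
move=> a1; apply: psum_contiguous.
- by apply: (kummer_coef_bounded (alpha + 1) nu); [lra|exact: laguerre_coef_kummer].
- exact: laguerre_coef_contiguous0.
- by move=> k; exact: laguerre_coef_contiguous.
Qed.

End laguerre.

(** * The quadratic inequality and the final bound *)

(** With A = alpha + x + 1, the difference (A + 2xq)^2 - (A^2 + 4 nu x) is 4x times the quadratic,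
    so comparing square roots suffices. *)
Lemma lt_of_quadratic_gt0 {R : realType} (alpha nu x q : R) :
  -1 < alpha -> 0 < x -> 0 < q ->
  0 < (alpha + 1 + x) * q + x * q ^+ 2 - nu ->
  alpha + x - 1 + Num.sqrt ((alpha + x + 1) ^+ 2 + 4 * nu * x) <
  2 * (alpha + x + x * q).
Proof.
move=> a1 x0 q0 quad; have xq0 : 0 < x * q by rewrite mulr_gt0.
have y0 : 0 < alpha + x + 1 + 2 * (x * q) by lra.
suff : Num.sqrt ((alpha + x + 1) ^+ 2 + 4 * nu * x) < alpha + x + 1 + 2 * (x * q).
  by lra.
rewrite -[ltRHS](ger0_norm (ltW y0)) -sqrtr_sqr ltr_sqrt; last by rewrite exprn_gt0.
rewrite -subr_gt0 (_ : _ - _ = 4 * x * ((alpha + 1 + x) * q + x * q ^+ 2 - nu));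
  last by ring.
by rewrite !mulr_gt0.
Qed.

Theorem theorem19 (R : realType) (alpha nu x : R) :
  -1 < alpha -> 0 < nu -> 0 < x ->
  Laguerre (nu + 1) (alpha - 1) (- x) / Laguerre nu alpha (- x) >
  (alpha + x - 1 + Num.sqrt ((alpha + x + 1) ^+ 2 + 4 * nu * x)) / (2 * (nu + 1)).
Proof.
move=> a1 nu0 x0; rewrite (LaguerreN (nu + 1)) (psum_laguerre_contiguous nu)// (LaguerreN nu).
rewrite (GammaS (nu + 1)); last by lra.
(* Both prefactors now share the same Gamma numerator, and their ratio is 1/(nu + 1). *)
rewrite (_ : nu + 1 + (alpha - 1) + 1 = nu + alpha + 1); last by ring.
have b0 : 0 < alpha + 1 by lra.
have rec := laguerre_coef_kummer nu _ a1.
have c0 : 0 < laguerre_coef nu alpha 0 by rewrite laguerre_coef0; exact: rGamma_gt0.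
have cb := kummer_coef_bounded _ _ _ b0 rec.
have := psum_kummer_gt0 _ _ _ _ b0 nu0 x0 rec c0.
have := psum_kummer_derive_gt0 _ _ _ _ b0 nu0 x0 rec c0.
have := psum_kummer_log_concave _ _ _ _ b0 nu0 x0 rec c0.
have := psum_kummer_ode _ _ _ x cb rec.
have : Gamma (nu + 1) != 0 by rewrite gt_eqF// Gamma_gt0//; lra.
have : Gamma (nu + alpha + 1) != 0 by rewrite gt_eqF// Gamma_gt0//; lra.
move: (Gamma (nu + 1)) (Gamma (nu + alpha + 1)) {rec c0 cb}.
move: (laguerre_coef nu alpha) => c.
move: (psum c x) (psum (pseries_diffs c) x) (psum (pseries_diffs (pseries_diffs c)) x).
move=> M M1 M2 g1 g2 g2_neq0 g1_neq0 ode lc M1_gt0 M_gt0.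
have M_neq0 : M != 0 by rewrite gt_eqF.
have nu1 : 0 < nu + 1 by lra.
have nu1_neq0 : nu + 1 != 0 by rewrite gt_eqF.
have -> : g2 / ((nu + 1) * g1) * ((alpha + x) * M + x * M1) / (g2 / g1 * M) =
    (2 * (alpha + x + x * (M1 / M))) / (2 * (nu + 1)).
  by field; rewrite g1_neq0 g2_neq0 M_neq0 nu1_neq0.
rewrite ltr_pM2r; last by rewrite invr_gt0 mulr_gt0.
apply: lt_of_quadratic_gt0 => //; first by rewrite divr_gt0.
(* Kummer's equation eliminates [nu], which leaves the log-concavity defect M'^2 - M M''. *)
have -> : (alpha + 1 + x) * (M1 / M) + x * (M1 / M) ^+ 2 - nu =
    x * (M1 ^+ 2 - M * M2) / M ^+ 2.
  have -> : nu = (x * M2 + (alpha + 1 + x) * M1) / M by rewrite ode mulfK.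
  by field.
by rewrite divr_gt0 ?exprn_gt0// mulr_gt0// subr_gt0.
Qed.
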